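(* Let $R$ be a ring. The power series ring $R[[x]]$ is a $U\sqrt{\Delta}$-ring if and only if $R$ is a $U\sqrt{\Delta}$-ring.
   Context: All rings are associative with identity. $R[[x]]$ is the ring of formal power series over $R$ in a variable $x$ commuting with the elements of $R$. For a ring $R$, $U(R)$ is its group of units, $\Delta(R)=\{x\in R \mid x+u\in U(R)\text{ for all }u\in U(R)\}$, and $\sqrt{\Delta(R)}=\{x\in R\mid x^n\in\Delta(R)\text{ for some integer }n\ge 1\}$. A ring $R$ is a $U\sqrt{\Delta}$-ring if every non-unit $a\in R$ can be written as $a=ub$ with $u\in U(R)$ and $b\in\sqrt{\Delta(R)}$. *)

(* Defs.v *)
From HB Require Import structures.
From mathcomp Require Import all_boot all_order all_algebra.
From mathcomp Require Import boolp.

Set Implicit Arguments.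
Unset Strict Implicit.
Unset Printing Implicit Defensive.

Import GRing.Theory.
Local Open Scope ring_scope.

(* A record wrapper rather than a bare nat -> R, so that the Cauchy product
   cannot be confused with a pointwise product of functions. The series
   \sum_n a_n x^n is represented by n |-> a_n. *)
Record fps (R : pzRingType) := FPS { fps_coef : nat -> R }.

HB.instance Definition _ (R : pzRingType) := gen_eqMixin (fps R).
HB.instance Definition _ (R : pzRingType) := gen_choiceMixin (fps R).

Section PowerSeriesRing.
Variable R : pzRingType.
Implicit Types f g h : fps R.

Definition fps_zero : fps R := FPS (fun=> 0).
Definition fps_opp f : fps R := FPS (fun n => - fps_coef f n).
Definition fps_add f g : fps R := FPS (fun n => fps_coef f n + fps_coef g n).
Definition fps_one : fps R := FPS (fun n => (n == 0)%:R).

(* Since x commutes with R, the product is the Cauchy product, with the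
   coefficients of the left factor kept on the left. *)
Definition fps_mul f g : fps R :=
  FPS (fun n => \sum_(i < n.+1) fps_coef f i * fps_coef g (n - i)).

Lemma fpsP f g : fps_coef f =1 fps_coef g -> f = g.
Proof. by case: f g => [a] [b] /= /funext ->. Qed.

Fact fps_addA : associative fps_add.
Proof. by move=> f g h; apply: fpsP => n /=; rewrite addrA. Qed.

Fact fps_addC : commutative fps_add.
Proof. by move=> f g; apply: fpsP => n /=; rewrite addrC. Qed.

Fact fps_add0 : left_id fps_zero fps_add.
Proof. by move=> f; apply: fpsP => n /=; rewrite add0r. Qed.

Fact fps_addN : left_inverse fps_zero fps_opp fps_add.
Proof. by move=> f; apply: fpsP => n /=; rewrite addNr. Qed.

Lemma fps_coef_mul_rev f g n :
  fps_coef (fps_mul f g) n =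
  \sum_(i < n.+1) fps_coef f (n - i) * fps_coef g i.
Proof.
rewrite /= (reindex_inj rev_ord_inj) /=.
by apply: eq_bigr => j _; rewrite (sub_ordK j).
Qed.

Fact fps_mulA : associative fps_mul.
Proof.
move=> f g h; apply: fpsP => n.
rewrite [RHS]fps_coef_mul_rev.
rewrite -[LHS]/(\sum_(j < n.+1) fps_coef f j * fps_coef (fps_mul g h) (n - j)).
pose coef3 j k := fps_coef f j * (fps_coef g (n - j - k) * fps_coef h k).
transitivity (\sum_(j < n.+1) \sum_(k < n.+1 | (k <= n - j)%N) coef3 j k).
  apply: eq_bigr => j _; rewrite fps_coef_mul_rev big_distrr /=.
  by rewrite (big_ord_narrow_leq (leq_subr _ _)).
rewrite (exchange_big_dep predT) //=; apply: eq_bigr => k _.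
transitivity (\sum_(j < n.+1 | (j <= n - k)%N) coef3 j k).
  apply: eq_bigl => j; rewrite -ltnS -(ltnS j) -!subSn ?leq_ord //.
  by rewrite -subn_gt0 -(subn_gt0 j) -!subnDA addnC.
rewrite (big_ord_narrow_leq (leq_subr _ _)) big_distrl /=.
by apply: eq_bigr => j _; rewrite /coef3 -!subnDA addnC mulrA.
Qed.

Fact fps_mul1l : left_id fps_one fps_mul.
Proof.
move=> f; apply: fpsP => n /=; rewrite big_ord_recl subn0 mul1r.
by rewrite big1 => [|j _]; rewrite ?addr0 // mul0r.
Qed.

Fact fps_mul1r : right_id fps_one fps_mul.
Proof.
move=> f; apply: fpsP => n; rewrite fps_coef_mul_rev /=.
rewrite big_ord_recl subn0 mulr1.
by rewrite big1 => [|j _]; rewrite ?addr0 // mulr0.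
Qed.

Fact fps_mulDl : left_distributive fps_mul fps_add.
Proof.
move=> f g h; apply: fpsP => n /=; rewrite -big_split.
by apply: eq_bigr => j _; rewrite mulrDl.
Qed.

Fact fps_mulDr : right_distributive fps_mul fps_add.
Proof.
move=> f g h; apply: fpsP => n /=; rewrite -big_split.
by apply: eq_bigr => j _; rewrite mulrDr.
Qed.

HB.instance Definition _ := GRing.isZmodule.Build (fps R)
  fps_addA fps_addC fps_add0 fps_addN.
HB.instance Definition _ := GRing.Zmodule_isPzRing.Build (fps R)
  fps_mulA fps_mul1l fps_mul1r fps_mulDl fps_mulDr.

End PowerSeriesRing.

Notation "{ 'fps' R }" := (fps R) (at level 0, R at level 200,
  format "{ 'fps'  R }") : type_scope.

(* GRing.unit is only available on unitRingType, which excludes the zero ring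
   and carries an inverse as structure; here R is an arbitrary ring. *)
Definition is_unit (R : pzRingType) (a : R) : Prop :=
  exists b : R, a * b = 1 /\ b * a = 1.

Definition Delta (R : pzRingType) (a : R) : Prop :=
  forall u : R, is_unit u -> is_unit (a + u).

Definition sqrt_Delta (R : pzRingType) (a : R) : Prop :=
  exists n : nat, (1 <= n)%N /\ Delta (a ^+ n).

Definition is_UsqrtDelta_ring (R : pzRingType) : Prop :=
  forall a : R, ~ is_unit a ->
    exists u b : R, [/\ is_unit u, sqrt_Delta b & a = u * b].

(* Main.v *)
Require Import Defs.
From mathcomp Require Import all_boot all_order all_algebra.
From HB Require Import structures.

(** The constant-coefficient map [R[[x]] -> R] is a surjective ring morphism,
    and a power series is a unit as soon as its constant coefficient is:
    the series [1 - h] with [h] divisible by [x] is inverted by the geometric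
    series [1 + h + h^2 + ...], which makes sense because [h^k] only affects
    coefficients of index at least [k] ([is_unit_fps]).

    The theorem then holds for formal reasons.  Along any surjective morphism
    that reflects units, an element is a unit, lies in [Delta], or lies in
    [sqrt_Delta] exactly when its image does, because the units of the target
    all lift to units ([Delta_local], [sqrt_Delta_local]).  Factorizations
    [a = u * b] can thus be pushed forward, and they can be lifted by lifting
    the unit [u] alone, since [b] is determined by [u] and [a]
    ([is_UsqrtDelta_ring_local]). *)

Set Implicit Arguments.
Unset Strict Implicit.
Unset Printing Implicit Defensive.

Import GRing.Theory.
Local Open Scope ring_scope.

Lemma is_unitM (S : pzRingType) (a b : S) :
  is_unit a -> is_unit b -> is_unit (a * b).
Proof.
move=> [a' [aa' a'a]] [b' [bb' b'b]]; exists (b' * a'); split.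
  by rewrite mulrA -(mulrA a) bb' mulr1.
by rewrite mulrA -(mulrA b') a'a mulr1.
Qed.

Lemma is_unit_rmorph (S T : pzRingType) (phi : {rmorphism S -> T}) (a : S) :
  is_unit a -> is_unit (phi a).
Proof.
by move=> [b [ab ba]]; exists (phi b); rewrite -!rmorphM ab ba !rmorph1.
Qed.

Section LocalMorphism.
Variables (S T : pzRingType) (phi : {rmorphism S -> T}).
Hypothesis phi_surj : forall y, exists x, phi x = y.
Hypothesis phi_local : forall x, is_unit (phi x) -> is_unit x.

(** Membership in [Delta] is tested on units, and every unit of [T] is the
    image of an element of [S], which is a unit because [phi] reflects units. *)
Lemma Delta_local a : Delta a <-> Delta (phi a).
Proof.
split=> Da u Uu.
  have [v phi_v] := phi_surj u; rewrite -phi_v -rmorphD.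
  by apply/is_unit_rmorph/Da/phi_local; rewrite phi_v.
by apply: phi_local; rewrite rmorphD; apply/Da/is_unit_rmorph.
Qed.

Lemma sqrt_Delta_local a : sqrt_Delta a <-> sqrt_Delta (phi a).
Proof.
split=> -[n [n_gt0 Dan]]; exists n; split=> //.
  by rewrite -rmorphXn; apply/Delta_local.
by apply/Delta_local; rewrite rmorphXn.
Qed.

Lemma is_UsqrtDelta_ring_local : is_UsqrtDelta_ring S <-> is_UsqrtDelta_ring T.
Proof.
split=> [US y nUy | UT a nUa].
  have [a phi_a] := phi_surj y.
  have [|u [b [Uu Db a_ub]]] := US a.
    by move=> /(is_unit_rmorph phi); rewrite phi_a.
  exists (phi u), (phi b); split; first exact: is_unit_rmorph.
    exact/sqrt_Delta_local.
  by rewrite -rmorphM -a_ub.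
have [|v [c [Uv Dc phi_a]]] := UT (phi a); first by move=> /phi_local.
have [u phi_u] := phi_surj v.
have Uu : is_unit u by apply: phi_local; rewrite phi_u.
have [u' [uu' u'u]] := Uu.
exists u, (u' * a); split=> //; last by rewrite mulrA uu' mul1r.
apply/sqrt_Delta_local.
by rewrite rmorphM phi_a -phi_u mulrA -rmorphM u'u rmorph1 mul1r.
Qed.

End LocalMorphism.

Section PowerSeriesUnits.
Variable R : pzRingType.
Implicit Types f g h : {fps R}.

Definition const_coef f : R := fps_coef f 0.
Definition fps_const (a : R) : {fps R} := FPS (fun n => if n == 0 then a else 0).

Lemma coef_fpsM f g n :
  fps_coef (f * g) n = \sum_(i < n.+1) fps_coef f i * fps_coef g (n - i).
Proof. by []. Qed.

Fact const_coef_is_zmod_morphism : zmod_morphism const_coef.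
Proof. by []. Qed.

Fact const_coef_is_monoid_morphism : monoid_morphism const_coef.
Proof.
by split=> // f g; rewrite /const_coef coef_fpsM big_ord1.
Qed.

HB.instance Definition _ :=
  GRing.isZmodMorphism.Build {fps R} R const_coef const_coef_is_zmod_morphism.
HB.instance Definition _ :=
  GRing.isMonoidMorphism.Build {fps R} R const_coef
    const_coef_is_monoid_morphism.

Lemma coef_fps_sum I (r : seq I) (F : I -> {fps R}) n :
  fps_coef (\sum_(i <- r) F i) n = \sum_(i <- r) fps_coef (F i) n.
Proof. by elim/big_rec2: _ => //= i y f _ <-. Qed.

Lemma coef_fpsX_lt h k n :
  const_coef h = 0 -> (n < k)%N -> fps_coef (h ^+ k) n = 0.
Proof.
move=> h0; elim: k n => // k IHk n lt_nk; rewrite exprS coef_fpsM.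
rewrite big1 // => -[[|i] lt_in] _ /=; first by rewrite [fps_coef h 0]h0 mul0r.
rewrite IHk ?mulr0 // ltn_subLR // addSn ltnS.
by rewrite (leq_trans _ (leq_addl i k)).
Qed.

(** The inverse is the geometric series in [h = 1 - f].  Its coefficient of
    index [n] only involves the powers [h ^+ k] with [k <= n], so each
    coefficient of the product with [f] can be computed with a finite partial
    sum, where the product telescopes. *)
Lemma fps_right_inverse f : const_coef f = 1 -> exists g, f * g = 1.
Proof.
move=> f0; pose h := 1 - f.
have h0 : const_coef h = 0 by rewrite rmorphB /= f0 rmorph1 subrr.
pose geo n : {fps R} := \sum_(k < n) h ^+ k.
have geo_stable m n : (m < n)%N -> fps_coef (geo n) m = fps_coef (geo m.+1) m.
  move=> lt_mn; rewrite /geo !coef_fps_sum.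
  rewrite (big_ord_widen n (fun k => fps_coef (h ^+ k) m) lt_mn).
  rewrite [LHS](bigID (fun k : 'I_n => (k < m.+1)%N)) /=.
  rewrite [X in _ + X]big1 ?addr0 // => k; rewrite -leqNgt.
  exact: coef_fpsX_lt.
exists (FPS (fun n => fps_coef (geo n.+1) n)); apply: fpsP => n.
have -> : fps_coef (f * FPS (fun m => fps_coef (geo m.+1) m)) n
        = fps_coef (f * geo n.+1) n.
  rewrite !coef_fpsM; apply: eq_bigr => i _ /=.
  by rewrite -(geo_stable _ n.+1) // ltnS leq_subr.
have -> : f * geo n.+1 = 1 - h ^+ n.+1.
  by rewrite -[f](subKr 1) -/h -opprB mulNr -subrX1 opprB.
by rewrite -[LHS]/(_ - fps_coef (h ^+ n.+1) n) coef_fpsX_lt ?subr0.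
Qed.

(** A right inverse of a series with constant coefficient [1] again has
    constant coefficient [1], so it has a right inverse too; hence it is a
    two-sided inverse. *)
Lemma is_unit_fps_const1 f : const_coef f = 1 -> is_unit f.
Proof.
move=> f0; have [g fg] := fps_right_inverse f0.
have g0 : const_coef g = 1.
  by move: (congr1 const_coef fg); rewrite rmorphM /= f0 mul1r rmorph1.
have [f' gf'] := fps_right_inverse g0; exists g; split=> //.
by rewrite -[f]mulr1 -gf' (mulrA f) fg mul1r.
Qed.

(** Multiplying by the inverse of the constant coefficient reduces to a series
    with constant coefficient [1]. *)
Lemma is_unit_fps f : is_unit (const_coef f) -> is_unit f.
Proof.
move=> [b [f0b bf0]].
have fps_constV a c : a * c = 1 -> fps_const a * fps_const c = 1.
  move=> ac; apply: fpsP => n; rewrite coef_fpsM big_ord_recl subn0 big1.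
    by rewrite addr0 /=; case: n => [|n]; rewrite ?ac ?mulr0.
  by move=> i _; rewrite mul0r.
have Ua : is_unit (fps_const (const_coef f)).
  by exists (fps_const b); rewrite !fps_constV.
have Ubf : is_unit (fps_const b * f).
  by apply: is_unit_fps_const1; rewrite rmorphM /= bf0.
have -> : f = fps_const (const_coef f) * (fps_const b * f).
  by rewrite mulrA fps_constV // mul1r.
exact: is_unitM.
Qed.

End PowerSeriesUnits.

Theorem corollary2p19 (R : pzRingType) :
  is_UsqrtDelta_ring {fps R} <-> is_UsqrtDelta_ring R.
Proof.
apply: (@is_UsqrtDelta_ring_local _ _ (@const_coef R)).
  by move=> a; exists (fps_const a).
exact: is_unit_fps.
Qed.
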